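(* Every abelian group $G$ with $s_0(G)=0$ is Hopfian.
   Context: $\mathbb N=\{0,1,2,\dots\}$ and $\mathbb N_+=\mathbb N\setminus\{0\}$. Let $\phi$ be an endomorphism of an abelian group $G$. A null string of $\phi$ is a sequence $S=\{x_n\}_{n\in\mathbb N}$ of pairwise distinct elements of $G$ such that $\phi(x_n)=x_{n-1}$ for every $n\in\mathbb N_+$, $x_0\neq 0$, and $\phi^k(x_0)=0$ for some $k\in\mathbb N_+$. Define $s_0(\phi)$ as the supremum of the cardinalities $|\mathcal F|$, where $\mathcal F$ ranges over the families of pairwise disjoint null strings of $\phi$; if this supremum is infinite it is set equal to the symbol $\infty$. For an abelian group $G$, $s_0(G)=\sup\{s_0(\phi):\phi\in\mathrm{End}(G)\}$. A group is Hopfian if each of its surjective endomorphisms is an automorphism. *)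

(* Defs.v *)
From mathcomp Require Import all_boot all_order all_algebra.
From mathcomp Require Import all_classical all_reals.
From mathcomp Require Import Rstruct ereal counting_measure.
From Stdlib Require Rdefinitions.

Set Implicit Arguments.
Unset Strict Implicit.
Unset Printing Implicit Defensive.

Import Order.TTheory GRing.Theory Num.Theory.

Local Open Scope classical_set_scope.
Local Open Scope ring_scope.

(* Cardinalities and their suprema are taken in the extended reals, where they
   are natural numbers or +oo: [counting] sends every infinite set to +oo. *)
Notation RR := Rdefinitions.R.

Definition null_string (G : zmodType) (phi : {additive G -> G})
    (x : nat -> G) : Prop :=
  [/\ injective x,
      forall n : nat, (0 < n)%N -> phi (x n) = x n.-1,
      x 0%N != 0
    & exists2 k : nat, (0 < k)%N & iter k phi (x 0%N) = 0].

(* Two null strings are disjoint when their ranges are. *)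
Definition disjoint_null_strings (G : zmodType) (phi : {additive G -> G})
    (F : set (nat -> G)) : Prop :=
  F `<=` null_string phi /\ trivIset F (fun x : nat -> G => range x).

Definition s0_end (G : zmodType) (phi : {additive G -> G}) : \bar RR :=
  ereal_sup [set counting F | F in disjoint_null_strings phi].

Definition s0 (G : zmodType) : \bar RR :=
  ereal_sup (range (fun phi : {additive G -> G} => s0_end phi)).

Definition hopfian (G : zmodType) : Prop :=
  forall phi : {additive G -> G},
    (forall y : G, exists x : G, phi x = y) -> bijective phi.

(* Main.v *)
Require Import Defs.
From mathcomp Require Import all_boot all_order all_algebra.
From mathcomp Require Import all_classical all_reals.
From mathcomp Require Import Rstruct ereal counting_measure.

(** A surjective endomorphism [phi] that is not injective kills some [a != 0],
    and lifting [a] over and over through a section of [phi] yields a sequence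
    going down to [a] and then to [0].  The number of applications of [phi]
    needed to reach [0] strictly increases along this sequence, so its terms are
    distinct and it is a null string ([null_string_of_section]).  A single null
    string is already a disjoint family of cardinality 1
    ([s0_ge1_of_null_string]), so [s0 G = 0] forces every surjective endomorphism
    to be injective; a section of it is then a two-sided inverse. *)

Import Order.TTheory GRing.Theory.
Local Open Scope classical_set_scope.
Local Open Scope ring_scope.

Lemma iter_section (T : Type) (f g : T -> T) (a : T) (n : nat) :
  cancel g f -> iter n f (iter n g a) = a.
Proof. by move=> gK; elim: n => //= n IH; rewrite -iterS iterSr gK. Qed.

(** Since [g] is only a set-theoretic section, distinctness cannot come from the
    additive structure of [g]; it comes from [phi]: for [m < n], the iterate
    [phi^n] sends the [n]-th term to [a] but the [m]-th term to [0]. *)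
Lemma null_string_of_section (G : zmodType) (phi : {additive G -> G})
    (g : G -> G) (a : G) :
  cancel g phi -> a != 0 -> phi a = 0 ->
  null_string phi (fun n => iter n g a).
Proof.
move=> gK a_neq0 phia.
have iter_phi0 k : iter k phi 0 = 0 by elim: k => //= k ->; rewrite raddf0.
have neq m n : (m < n)%N -> iter m g a <> iter n g a.
  move=> lt_mn eq_mn; move: (iter_section _ phi g a n gK).
  rewrite -eq_mn -(subnK lt_mn) iterD iterS iter_section // phia iter_phi0.
  by move/eqP; rewrite eq_sym (negPf a_neq0).
split=> //.
- move=> m n /= eq_mn; case: (ltngtP m n) => // lt; exfalso.
    exact: neq lt eq_mn.
  exact: neq lt (esym eq_mn).
- by case=> // n _ /=; rewrite gK.
- by exists 1%N.
Qed.

Lemma s0_ge1_of_null_string (G : zmodType) (phi : {additive G -> G})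
    (x : nat -> G) : null_string phi x -> (1 <= s0 G)%E.
Proof.
move=> hx; apply: (@le_trans _ _ (s0_end phi)); last first.
  by apply: ereal_sup_ubound; exists phi.
apply: ereal_sup_ubound; exists [set x].
  split; first by move=> _ ->.
  by move=> y z -> ->.
rewrite /counting asboolT; last exact: finite_set1.
by rewrite fset_set1 finmap.cardfs1.
Qed.

Theorem theorem6p1 (G : zmodType) (hG : s0 G = 0%E) : hopfian G.
Proof.
move=> phi phi_surj; have [g gK] := choice phi_surj.
have ker0 a : phi a = 0 -> a = 0.
  move=> phia; apply/eqP; apply/negPn/negP => a_neq0.
  have /s0_ge1_of_null_string := null_string_of_section _ _ _ _ gK a_neq0 phia.
  by rewrite hG lee_fin Num.Theory.ler10.
exists g => // x; apply/eqP; rewrite -subr_eq0; apply/eqP.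
by apply: ker0; rewrite raddfB gK subrr.
Qed.
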